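(* Let input-state data $(U_-,X)$, instrumental data $R_-\in\mathbb{R}^{M\times N}$ and a symmetric matrix $Q$ with $Q_{22}\prec0$ be given, as in the context, and let $\Lambda_X\in\mathbb{R}^{(2n+m)\times(2n+m)}$ be the matrix defined there. Suppose that there exists a matrix $Z\in\mathbb{R}^{(n+m)\times n}$ such that $$\begin{bmatrix}I\\Z\end{bmatrix}^\top\Lambda_X\begin{bmatrix}I\\Z\end{bmatrix}\succ0 .$$ Then the data $(U_-,X)$ are informative for quadratic stabilization by state feedback if and only if there exist $L\in\mathbb{R}^{m\times n}$, $P\in\mathbb{R}^{n\times n}$ with $P\succ0$, $\alpha\ge0$ and $\beta>0$ such that $$\begin{bmatrix}P-\beta I&0&0&0\\0&-P&-L^\top&0\\0&-L&0&L\\0&0&L^\top&P\end{bmatrix}-\alpha\begin{bmatrix}\Lambda_X&0\\0&0\end{bmatrix}\succeq0.\qquad( * )$$ Moreover, if $L$ and $P\succ0$ satisfy $( * )$ (for some $\alpha\ge0$, $\beta>0$) and $K:=LP^{-1}$, then $A+BK$ is stable (all its eigenvalues lie in the open unit disk) for all $(A,B)\in\Sigma^{RQ}_{(U_-,X)}$.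
   Context: All matrices are real; $\succ,\succeq,\prec$ refer to symmetric matrices in the (semi)definite order. Zero and identity blocks have the dimensions dictated by conformity. System and data. The system class is $x(t+1)=Ax(t)+Bu(t)+e(t)$ with measured state $x(t)\in\mathbb{R}^n$, input $u(t)\in\mathbb{R}^m$ and unmeasured noise $e(t)\in\mathbb{R}^n$; $A\in\mathbb{R}^{n\times n}$, $B\in\mathbb{R}^{n\times m}$ are unknown. The data are $U_-=[u(0)\cdots u(N-1)]$ and $X=[x(0)\cdots x(N)]$, with $X_-=[x(0)\cdots x(N-1)]$, $X_+=[x(1)\cdots x(N)]$; $E_-=[e(0)\cdots e(N-1)]$ is unknown. The data equation is $$X_+=AX_-+BU_-+E_-.\quad\text{(D)}$$ Noise bound. A given instrumental signal $r(t)\in\mathbb{R}^M$ defines $R_-=[r(0)\cdots r(N-1)]\in\mathbb{R}^{M\times N}$. With a given symmetric matrix $Q=\begin{bmatrix}Q_{11}&Q_{12}\\Q_{12}^\top&Q_{22}\end{bmatrix}$, $Q_{11}\in\mathbb{R}^{n\times n}$, $Q_{22}\in\mathbb{R}^{M\times M}$, $Q_{22}\prec0$, the noise is known to satisfy $$\begin{bmatrix}I\\R_-E_-^\top\end{bmatrix}^\top Q\begin{bmatrix}I\\R_-E_-^\top\end{bmatrix}\succeq0.\quad\text{(N)}$$ Compatible systems: $\Sigma^{RQ}_{(U_-,X)}:=\{(A,B)\mid\exists E_-\in\mathbb{R}^{n\times N}\text{ such that (N) and (D) hold}\}$. The matrix $\Lambda_X$ is $$\Lambda_X:=\begin{bmatrix}I&X_+R_-^\top\\0&-X_-R_-^\top\\0&-U_-R_-^\top\end{bmatrix}Q\begin{bmatrix}I&X_+R_-^\top\\0&-X_-R_-^\top\\0&-U_-R_-^\top\end{bmatrix}^\top.$$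 Informativity. The data $(U_-,X)$ are informative for quadratic stabilization by state feedback if there exist $K\in\mathbb{R}^{m\times n}$ and $P\succ0$ such that $\Sigma^{RQ}_{(U_-,X)}\subseteq\{(A,B)\mid(A+BK)P(A+BK)^\top-P\prec0\}$. *)

(* Defs.v *)
From HB Require Import structures.
From mathcomp Require Import all_boot all_order all_algebra.
From mathcomp Require Import complex.
From mathcomp Require Import classical_sets reals.
Set Implicit Arguments.
Unset Strict Implicit.
Unset Printing Implicit Defensive.
Import Order.TTheory GRing.Theory Num.Theory.
Local Open Scope classical_set_scope.
Local Open Scope ring_scope.
Local Open Scope complex_scope.

(* Definiteness includes symmetry. *)
Definition posdefmx (R : realType) (n : nat) (S : 'M[R]_n) : Prop :=
  S^T = S /\ forall v : 'cV[R]_n, v != 0 -> 0 < (v^T *m S *m v) 0 0.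

Definition possemidefmx (R : realType) (n : nat) (S : 'M[R]_n) : Prop :=
  S^T = S /\ forall v : 'cV[R]_n, 0 <= (v^T *m S *m v) 0 0.

Definition negdefmx (R : realType) (n : nat) (S : 'M[R]_n) : Prop :=
  S^T = S /\ forall v : 'cV[R]_n, v != 0 -> (v^T *m S *m v) 0 0 < 0.

(* Stability in discrete time: the complex eigenvalues of the real matrix S
   lie in the open unit disk. *)
Definition stablemx_dt (R : realType) (n : nat) (S : 'M[R]_n) : Prop :=
  forall z : R[i], eigenvalue (map_mx (real_complex R) S) z -> `|z| < 1.

(* X = [x(0) ... x(N)]: dropping the last column gives [x(0) ... x(N-1)],
   dropping the first one gives [x(1) ... x(N)]. *)
Definition Xminus (R : realType) (n N : nat) (X : 'M[R]_(n, N.+1)) :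
  'M[R]_(n, N) := col' ord_max X.

Definition Xplus (R : realType) (n N : nat) (X : 'M[R]_(n, N.+1)) :
  'M[R]_(n, N) := col' ord0 X.

Definition data_equation (R : realType) (n m N : nat)
    (U : 'M[R]_(m, N)) (X : 'M[R]_(n, N.+1))
    (A : 'M[R]_n) (B : 'M[R]_(n, m)) (E : 'M[R]_(n, N)) : Prop :=
  Xplus X = A *m Xminus X + B *m U + E.

Definition noise_bound (R : realType) (n M N : nat)
    (Rm : 'M[R]_(M, N)) (Q : 'M[R]_(n + M)) (E : 'M[R]_(n, N)) : Prop :=
  possemidefmx ((col_mx 1%:M (Rm *m E^T))^T *m Q *m col_mx 1%:M (Rm *m E^T)).

Definition compatible_systems (R : realType) (n m M N : nat)
    (U : 'M[R]_(m, N)) (X : 'M[R]_(n, N.+1))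
    (Rm : 'M[R]_(M, N)) (Q : 'M[R]_(n + M)) : set ('M[R]_n * 'M[R]_(n, m)) :=
  [set AB | exists E : 'M[R]_(n, N),
              noise_bound Rm Q E /\ data_equation U X AB.1 AB.2 E].

Definition LambdaX_factor (R : realType) (n m M N : nat)
    (U : 'M[R]_(m, N)) (X : 'M[R]_(n, N.+1)) (Rm : 'M[R]_(M, N)) :
    'M[R]_(n + (n + m), n + M) :=
  block_mx 1%:M (Xplus X *m Rm^T)
           0    (col_mx (- (Xminus X *m Rm^T)) (- (U *m Rm^T))).

Definition LambdaX (R : realType) (n m M N : nat)
    (U : 'M[R]_(m, N)) (X : 'M[R]_(n, N.+1))
    (Rm : 'M[R]_(M, N)) (Q : 'M[R]_(n + M)) : 'M[R]_(n + (n + m)) :=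
  LambdaX_factor U X Rm *m Q *m (LambdaX_factor U X Rm)^T.

Definition informative_quadratic_stabilization (R : realType) (n m M N : nat)
    (U : 'M[R]_(m, N)) (X : 'M[R]_(n, N.+1))
    (Rm : 'M[R]_(M, N)) (Q : 'M[R]_(n + M)) : Prop :=
  exists (K : 'M[R]_(m, n)) (P : 'M[R]_n), posdefmx P /\
    compatible_systems U X Rm Q `<=`
      [set AB | negdefmx
        ((AB.1 + AB.2 *m K) *m P *m (AB.1 + AB.2 *m K)^T - P)].

(* The 4 x 4 block matrix of sizes n, n, m, n, nested as (n + (n + m)) + n so
   that its leading part is conformal with LambdaX:
     P - beta I    0     0    0
         0        -P   -L^T   0
         0        -L     0    L
         0         0    L^T   P   *)
Definition lmi_blocks (R : realType) (n m : nat)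
    (L : 'M[R]_(m, n)) (P : 'M[R]_n) (beta : R) : 'M[R]_(n + (n + m) + n) :=
  block_mx
    (block_mx (P - beta%:M) 0
              0             (block_mx (- P) (- L^T)
                                      (- L) 0))
    (col_mx 0 (col_mx 0 L))
    (row_mx 0 (row_mx 0 L^T))
    P.

Definition stabilization_lmi (R : realType) (n m M N : nat)
    (U : 'M[R]_(m, N)) (X : 'M[R]_(n, N.+1))
    (Rm : 'M[R]_(M, N)) (Q : 'M[R]_(n + M))
    (L : 'M[R]_(m, n)) (P : 'M[R]_n) (alpha beta : R) : Prop :=
  possemidefmx
    (lmi_blocks L P beta - alpha *: block_mx (LambdaX U X Rm Q) 0 0 0).

(* Main.v *)
(* Write a system as the row map x |-> x [A B].  Compatibility of (A, B) with the
   data then says that the form of Lambda_X is nonnegative on the graph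
   {(x, x [A B])}, and the Lyapunov inequality says that the form
   (x, y) |-> x P x^T - (y [I; K]) P (y [I; K])^T is positive there (x <> 0).
   Every vector (x, y) with x <> 0 on which Lambda_X is nonnegative lies on the
   graph of a compatible system, by a rank one interpolation, so informativity
   is an implication between two scalar quadratic forms; the S-lemma converts
   it into the multiplier alpha, compactness gives the margin beta, and (star)
   is the resulting inequality after a Schur complement.  Stability follows by
   testing the Lyapunov inequality on the real and imaginary parts of a left
   eigenvector. *)
Require Import Defs.
From HB Require Import structures.
From mathcomp Require Import all_boot all_order all_algebra.
From mathcomp Require Import complex.
From mathcomp Require Import classical_sets reals.
From mathcomp Require Import boolp topology normedtype derive.
From mathcomp Require Import ring lra.
Set Implicit Arguments.
Unset Strict Implicit.
Unset Printing Implicit Defensive.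
Import Order.TTheory GRing.Theory Num.Theory.
Import numFieldNormedType.Exports.
Local Open Scope classical_set_scope.
Local Open Scope ring_scope.

(** * Bilinear and quadratic forms on row vectors *)

Definition bf (R : realType) (p q : nat) (S : 'M[R]_(p, q)) (u : 'rV[R]_p)
  (v : 'rV[R]_q) : R := (u *m S *m v^T) 0 0.

Notation qf S u := (bf S u u).

Section BilinearForms.
Variable R : realType.
Implicit Types (p q : nat).

Lemma bfDl p q (S : 'M[R]_(p, q)) u u' v : bf S (u + u') v = bf S u v + bf S u' v.
Proof. by rewrite /bf !mulmxDl mxE. Qed.

Lemma bfDr p q (S : 'M[R]_(p, q)) u v v' : bf S u (v + v') = bf S u v + bf S u v'.
Proof. by rewrite /bf linearD mulmxDr mxE. Qed.

Lemma bfZl p q (S : 'M[R]_(p, q)) a u v : bf S (a *: u) v = a * bf S u v.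
Proof. by rewrite /bf -!scalemxAl mxE. Qed.

Lemma bfZr p q (S : 'M[R]_(p, q)) a u v : bf S u (a *: v) = a * bf S u v.
Proof. by rewrite /bf linearZ -scalemxAr mxE. Qed.

Lemma bf0l p q (S : 'M[R]_(p, q)) v : bf S 0 v = 0.
Proof. by rewrite /bf !mul0mx mxE. Qed.

Lemma bfNl p q (S : 'M[R]_(p, q)) u v : bf S (- u) v = - bf S u v.
Proof. by rewrite /bf !mulNmx mxE. Qed.

Lemma bfNr p q (S : 'M[R]_(p, q)) u v : bf S u (- v) = - bf S u v.
Proof. by rewrite /bf linearN mulmxN mxE. Qed.

Lemma bfDm p q (S S' : 'M[R]_(p, q)) u v : bf (S + S') u v = bf S u v + bf S' u v.
Proof. by rewrite /bf mulmxDr mulmxDl mxE. Qed.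

Lemma bfNm p q (S : 'M[R]_(p, q)) u v : bf (- S) u v = - bf S u v.
Proof. by rewrite /bf mulmxN mulNmx mxE. Qed.

Lemma bfZm p q (S : 'M[R]_(p, q)) a u v : bf (a *: S) u v = a * bf S u v.
Proof. by rewrite /bf -scalemxAr -scalemxAl mxE. Qed.

Lemma bf0m p q u v : bf (0 : 'M[R]_(p, q)) u v = 0.
Proof. by rewrite /bf mulmx0 mul0mx mxE. Qed.

Lemma bfT p q (S : 'M[R]_(p, q)) u v : bf S^T u v = bf S v u.
Proof.
by rewrite /bf -[v *m S *m u^T]trmxK [RHS]mxE !trmx_mul trmxK mulmxA.
Qed.

Lemma bf_sym p (S : 'M[R]_p) u v : S^T = S -> bf S u v = bf S v u.
Proof. by move=> Ssym; rewrite -bfT Ssym. Qed.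

Lemma bf_mul p q p' q' (A : 'M[R]_(p, p')) (S : 'M_(p', q')) (B : 'M_(q, q')) u v :
  bf (A *m S *m B^T) u v = bf S (u *m A) (v *m B).
Proof. by rewrite /bf trmx_mul !mulmxA. Qed.

Lemma bf_block p p' q q' (A : 'M[R]_(p, q)) (B : 'M_(p, q')) (C : 'M_(p', q))
    (D : 'M_(p', q')) u u' v v' :
  bf (block_mx A B C D) (row_mx u u') (row_mx v v') =
  bf A u v + bf B u v' + bf C u' v + bf D u' v'.
Proof.
rewrite /bf mul_row_block tr_row_mx mul_row_col !mulmxDl !mxE; ring.
Qed.

Lemma bf_col p p' q (A : 'M[R]_(p, q)) (B : 'M_(p', q)) u u' v :
  bf (col_mx A B) (row_mx u u') v = bf A u v + bf B u' v.
Proof. by rewrite /bf mul_row_col mulmxDl mxE. Qed.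

Lemma bf_row p q q' (A : 'M[R]_(p, q)) (B : 'M_(p, q')) u v v' :
  bf (row_mx A B) u (row_mx v v') = bf A u v + bf B u v'.
Proof. by rewrite /bf mul_mx_row tr_row_mx mul_row_col mxE. Qed.

Lemma qfDZ p (S : 'M[R]_p) u v t : S^T = S ->
  qf S (u + t *: v) = qf S u + 2 * t * bf S u v + t ^+ 2 * qf S v.
Proof.
move=> Ssym; rewrite !bfDl !bfDr !bfZl !bfZr (bf_sym v u Ssym); ring.
Qed.

Lemma qf1 p (u : 'rV[R]_p) : qf 1%:M u = \sum_i u 0 i ^+ 2.
Proof.
by rewrite /bf mulmx1 mxE; apply: eq_bigr => i _; rewrite mxE expr2.
Qed.

(** This and its two companions pass from columns to rows, because systems act here on the right of
    row vectors. *)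
Lemma posdefmxP p (S : 'M[R]_p) :
  posdefmx S <-> S^T = S /\ forall u : 'rV_p, u != 0 -> 0 < qf S u.
Proof.
split=> -[Ssym Spos]; split=> // u u0; last first.
  by have := Spos u^T; rewrite trmx_eq0 /bf trmxK => ->.
by have := Spos u^T; rewrite trmx_eq0 /bf trmxK => ->.
Qed.

Lemma negdefmxP p (S : 'M[R]_p) :
  negdefmx S <-> S^T = S /\ forall u : 'rV_p, u != 0 -> qf S u < 0.
Proof.
split=> -[Ssym Spos]; split=> // u u0; last first.
  by have := Spos u^T; rewrite trmx_eq0 /bf trmxK => ->.
by have := Spos u^T; rewrite trmx_eq0 /bf trmxK => ->.
Qed.

Lemma possemidefmxP p (S : 'M[R]_p) :
  possemidefmx S <-> S^T = S /\ forall u : 'rV_p, 0 <= qf S u.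
Proof.
split=> -[Ssym Spos]; split=> // u; last first.
  by have := Spos u^T; rewrite /bf trmxK.
by have := Spos u^T; rewrite /bf trmxK.
Qed.

Lemma posdefmxW p (S : 'M[R]_p) : posdefmx S -> possemidefmx S.
Proof.
move=> /posdefmxP[Ssym Spos]; apply/possemidefmxP; split=> // u.
by have [->|/Spos/ltW//] := eqVneq u 0; rewrite bf0l.
Qed.

Lemma bf_eq0 p q (S : 'M[R]_(p, q)) u : u *m S = 0 -> forall v, bf S u v = 0.
Proof. by rewrite /bf => -> v; rewrite mul0mx mxE. Qed.

Lemma bf_ker p q (S : 'M[R]_(p, q)) u : (forall v, bf S u v = 0) -> u *m S = 0.
Proof.
move=> Su; apply/rowP=> i; rewrite [RHS]mxE -(Su (delta_mx 0 i)) /bf.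
by rewrite trmx_delta -colE [RHS]mxE.
Qed.

(** The quadratic polynomial [t |-> qf S (u + t *: v)] is nonnegative, hence has discriminant at
    most zero. *)
Lemma cauchy_schwarz_psd p (S : 'M[R]_p) u v : possemidefmx S ->
  bf S u v ^+ 2 <= qf S u * qf S v.
Proof.
move=> /possemidefmxP[Ssym Spos].
have disc t : 0 <= qf S u + 2 * t * bf S u v + t ^+ 2 * qf S v.
  by rewrite -qfDZ.
have := Spos v; have := Spos u; move: disc.
move: (qf S u) (qf S v) (bf S u v) => a c b disc a0.
rewrite le_eqVlt => /orP[/eqP c0|c0]; first rewrite -c0 in disc *.
  have [->|b0] := eqVneq b 0; first by rewrite expr0n /= mulr0.
  (* With [c = 0] the polynomial is affine; this [t] gives it the value -1. *)
  have := disc (- (a + 1) / (2 * b)).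
  have -> : a + 2 * (- (a + 1) / (2 * b)) * b + (- (a + 1) / (2 * b)) ^+ 2 * 0 = - 1.
    by field.
  by lra.
have := disc (- b / c).
have -> : a + 2 * (- b / c) * b + (- b / c) ^+ 2 * c = (a * c - b ^+ 2) / c.
  by field; rewrite gt_eqF.
by rewrite pmulr_lge0 ?invr_gt0 // subr_ge0.
Qed.

Lemma psd_ker p (S : 'M[R]_p) u : possemidefmx S -> qf S u = 0 -> u *m S = 0.
Proof.
move=> Spsd Su; apply: bf_ker => v; apply/eqP; rewrite -sqrf_eq0 eq_le sqr_ge0.
by rewrite (le_trans (cauchy_schwarz_psd u v Spsd)) ?Su ?mul0r.
Qed.

End BilinearForms.

(** * The S-lemma for two quadratic forms *)

Section SLemma.
Variable R : realType.

(* The line through [w] in direction [u] meets [G = 0] at two points on opposite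
   sides of [w]; the positive combination of [F >= 0] at these points which
   cancels the mixed term is the claim. *)
Lemma S_lemma_cross p (F G : 'M[R]_p) (u w : 'rV_p) : F^T = F -> G^T = G ->
  (forall v, 0 <= qf G v -> 0 <= qf F v) ->
  qf G u < 0 -> 0 < qf G w -> qf F w * qf G u <= qf F u * qf G w.
Proof.
move=> Fsym Gsym FG; set c := qf G u; set a := qf G w => c0 a0.
set b := bf G w u; set s := Num.sqrt (b ^+ 2 - a * c).
have ac0 : a * c < 0 by rewrite pmulr_rlt0.
have s2 : s ^+ 2 = b ^+ 2 - a * c.
  by rewrite sqr_sqrtr //; have := sqr_ge0 b; lra.
have s0 : 0 <= s by apply: sqrtr_ge0.
have [bs bs'] : b < s /\ - s < b.
  have : b ^+ 2 < s ^+ 2 by lra.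
  by split; nra.
(* Scaling [w] by [c] puts the zeros of [G] on the line at [t = - b + s] and [t = - b - s], with no
   division. *)
have on_line t : qf F (c *: w + t *: u) =
    c ^+ 2 * qf F w + 2 * t * c * bf F w u + t ^+ 2 * qf F u.
  by rewrite qfDZ // !bfZl !bfZr; ring.
have zero t : t ^+ 2 + 2 * t * b + a * c = 0 ->
    0 <= c ^+ 2 * qf F w + 2 * t * c * bf F w u + t ^+ 2 * qf F u.
  move=> t0; rewrite -on_line; apply: FG.
  have -> : qf G (c *: w + t *: u) = c * (t ^+ 2 + 2 * t * b + a * c).
    by rewrite qfDZ // !bfZl !bfZr -/a -/b -/c; ring.
  by rewrite t0 mulr0.
have z1 : 0 <= c ^+ 2 * qf F w + 2 * (s - b) * c * bf F w u + (s - b) ^+ 2 * qf F u.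
  by apply: zero; rewrite sqrrB s2; ring.
have z2 : 0 <= c ^+ 2 * qf F w + 2 * (- s - b) * c * bf F w u + (- s - b) ^+ 2 * qf F u.
  by apply: zero; rewrite sqrrB sqrrN s2; ring.
have : 0 <=
    (s + b) * (c ^+ 2 * qf F w + 2 * (s - b) * c * bf F w u +
               (s - b) ^+ 2 * qf F u) +
    (s - b) * (c ^+ 2 * qf F w + 2 * (- s - b) * c * bf F w u +
               (- s - b) ^+ 2 * qf F u).
  by rewrite addr_ge0 // mulr_ge0 //; lra.
set e := (X in 0 <= X).
have -> : e = 2 * s * c * (c * qf F w) + 2 * s * (s ^+ 2 - b ^+ 2) * qf F u.
  by rewrite /e; ring.
rewrite s2.
have -> : 2 * s * c * (c * qf F w) + 2 * s * (b ^+ 2 - a * c - b ^+ 2) * qf F u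
   = (2 * s * - c) * (qf F u * a - qf F w * c) by ring.
by rewrite pmulr_rge0 ?subr_ge0 // mulr_gt0 //; lra.
Qed.

(** By [S_lemma_cross], every ratio [F / G] taken where [G < 0] lies below every ratio taken where
    [G > 0]. The infimum of the latter separates the two families and serves as [alpha]. *)
Lemma S_lemma p (F G : 'M[R]_p) : F^T = F -> G^T = G ->
  (exists w, 0 < qf G w) -> (forall w, 0 <= qf G w -> 0 <= qf F w) ->
  exists2 alpha, 0 <= alpha & forall w, alpha * qf G w <= qf F w.
Proof.
move=> Fsym Gsym [w0 Gw0] FG.
pose E := [set r | exists2 w, 0 < qf G w & r = qf F w / qf G w].
have E0 : E !=set0 by exists (qf F w0 / qf G w0), w0.
have lbE0 : lbound E 0.
  by move=> _ [w Gw ->]; rewrite divr_ge0 ?(ltW Gw) // FG // ltW.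
exists (inf E); first exact: lb_le_inf.
move=> w; have [Gw|Gw|Gw] := ltgtP (qf G w) 0.
- rewrite -ler_ndivrMr //; apply: lb_le_inf => // _ [v Gv ->].
  rewrite ler_pdivlMr // mulrAC ler_ndivrMr //.
  exact: S_lemma_cross.
- by rewrite -ler_pdivlMr //; apply: ge_inf; [exists 0 | exists w].
- by rewrite Gw mulr0 FG // Gw.
Qed.

End SLemma.

(** * The strict S-lemma, modulo the kernel of a semidefinite form *)

Section StrictSLemma.
Variable R : realType.

(** When [w = w T T'], the coordinate [w 0 i] is the pairing under [T] of [w] with a fixed vector,
    so Cauchy-Schwarz bounds it. It is used with [T'] a pseudo-inverse or the inverse of [T]. *)
Lemma psd_coord_bound p (T T' : 'M[R]_p) : possemidefmx T ->
  exists2 k : R, 0 <= k &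
    forall w : 'rV_p, w *m T *m T' = w -> forall i, w 0 i ^+ 2 <= k * qf T w.
Proof.
move=> Tpsd; have [Tsym Tpos] := (possemidefmxP T).1 Tpsd.
exists (\sum_i qf T (row i T'^T)); first by apply: sumr_ge0.
move=> w wT i.
have -> : w 0 i = bf T w (row i T'^T).
  by rewrite /bf tr_row trmxK -[in LHS]wT !mxE; apply: eq_bigr => j _; rewrite !mxE.
apply: (le_trans (cauchy_schwarz_psd _ _ Tpsd)).
rewrite mulrC; apply: ler_wpM2r; first exact: Tpos.
by rewrite (bigD1 i) //= lerDl sumr_ge0.
Qed.

Lemma psd1 p : possemidefmx (1%:M : 'M[R]_p).
Proof.
apply/possemidefmxP; split=> [|u]; first exact: trmx1.
by rewrite qf1 sumr_ge0 // => i _; rewrite sqr_ge0.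
Qed.

Lemma qf_continuous p (S : 'M[R]_p) : continuous (fun w : 'rV[R]_p => qf S w).
Proof.
have -> : (fun w : 'rV[R]_p => qf S w) =
    fun w => \sum_j (\sum_i w 0 i * S i j) * w 0 j.
  apply/funext => w; rewrite /bf mxE; apply: eq_bigr => j _; rewrite !mxE.
  by congr (_ * _); apply: eq_bigr.
have sum_cont (h : 'I_p -> 'rV[R]_p -> R) : (forall i, continuous (h i)) ->
    continuous (fun w => \sum_i h i w).
  by move=> hc; apply: continuous_big => // ?; exact: add_continuous.
have row_cont j : continuous (fun w : 'rV[R]_p => \sum_i w 0 i * S i j).
  refine (sum_cont _ _) => i w.
  by apply: continuousM; [exact: coord_continuous | exact: cst_continuous].
refine (sum_cont _ _) => j w.
by apply: continuousM; [exact: row_cont | exact: coord_continuous].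
Qed.

(** Boundedness is [psd_coord_bound]. For closedness, the fixed-point equation is rewritten as the
    vanishing of the squared norm of [w (T T' - 1)], so each condition is the preimage of a closed
    set under a continuous quadratic form. *)
Lemma psd_compact p (T T' G : 'M[R]_p) : possemidefmx T ->
  compact [set w : 'rV[R]_p | [/\ w *m T *m T' = w, qf T w = 1 & 0 <= qf G w]].
Proof.
move=> Tpsd; have [k k0 bound] := psd_coord_bound T' Tpsd.
(* The radius [k + 1] avoids a square root: [w_i ^ 2 <= k] gives [|w_i| <= k + 1]. *)
apply: (@subclosed_compact _ _
  [set w : 'rV[R]_p | forall i, `[- (k + 1), k + 1]%classic (w 0 i)]).
- pose D := T *m T' - 1%:M.
  have -> : [set w : 'rV[R]_p | [/\ w *m T *m T' = w, qf T w = 1 & 0 <= qf G w]] =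
      (fun w => qf (D *m 1%:M *m D^T) w) @^-1` [set x | x = 0] `&`
      ((fun w => qf T w) @^-1` [set x | x = 1] `&`
       (fun w => qf G w) @^-1` [set x | 0 <= x]).
    have fixP w : w *m T *m T' = w <-> qf (D *m 1%:M *m D^T) w = 0.
      rewrite bf_mul mulmxBr mulmx1 mulmxA; split=> [->|/psd_ker].
        by rewrite subrr bf0l.
      by rewrite mulmx1 => /(_ (psd1 _))/eqP; rewrite subr_eq0 => /eqP.
    by apply/seteqP; split=> w /=; [case=> /fixP | case=> /fixP ? []].
  have preim (S : 'M[R]_p) (E : set R) : closed E ->
      closed ((fun w : 'rV[R]_p => qf S w) @^-1` E).
    by move=> Ecl; apply: closed_comp => // w _; exact: qf_continuous.
  apply: closedI; first by apply: preim; exact: closed_eq.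
  apply: closedI; apply: (preim); [exact: closed_eq | exact: closed_ge].
- by apply: (@rV_compact R p (fun=> `[- (k + 1), k + 1]%classic)) => i;
  apply: segment_compact.
- move=> w [wT Tw _] i /=; rewrite in_itv /=.
  have := bound w wT i; rewrite Tw mulr1 => wi.
  by apply/andP; split; nra.
Qed.

(** The kernel hypothesis lets [F] and [G] descend to the quotient by the kernel of [T], where
    [qf T = 1] cuts out a compact set. The minimum [c] of [F] on its part with [G >= 0] is positive,
    and the S-lemma applies to [F - c T]. *)
Lemma strict_S_lemma p (T F G : 'M[R]_p) :
  possemidefmx T -> F^T = F -> G^T = G ->
  (forall w : 'rV_p, w *m T = 0 -> w *m F = 0 /\ w *m G = 0) ->
  (exists w, 0 < qf G w) ->
  (forall w : 'rV_p, w *m T != 0 -> 0 <= qf G w -> 0 < qf F w) ->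
  exists alpha c, [/\ 0 <= alpha, 0 < c &
    forall w, alpha * qf G w + c * qf T w <= qf F w].
Proof.
move=> Tpsd Fsym Gsym kerT slater FG.
have [Tsym Tpos] := (possemidefmxP T).1 Tpsd.
(* The vector [w T T'] represents [w] modulo the kernel of [T], so the forms of [T], [F] and [G]
   agree on the two. *)
pose T' := pinvmx T.
have TT'T w : w *m T *m T' *m T = w *m T by apply: mulmxKpV; apply: submxMl.
have proj S w : S^T = S -> (forall v : 'rV_p, v *m T = 0 -> v *m S = 0) ->
    qf S (w *m T *m T') = qf S w.
  move=> Ssym kerS; have /kerS/eqP : (w *m T *m T' - w) *m T = 0.
    by rewrite mulmxBl TT'T subrr.
  rewrite mulmxBl subr_eq0 => /eqP eqS.
  by rewrite [LHS]/bf eqS -/(bf S w _) bf_sym // [LHS]/bf eqS.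
have [c c0 Fc] : exists2 c, 0 < c & forall w, 0 <= qf G w -> c * qf T w <= qf F w.
  pose C := [set w : 'rV[R]_p | [/\ w *m T *m T' = w, qf T w = 1 & 0 <= qf G w]].
  have normalize w : w *m T != 0 -> 0 <= qf G w ->
      0 < qf T w /\ C ((Num.sqrt (qf T w))^-1 *: (w *m T *m T')).
    move=> wT Gw.
    have Tw : 0 < qf T w.
      rewrite lt_neqAle Tpos andbT eq_sym; apply: contra wT => /eqP Tw.
      by rewrite psd_ker.
    split=> //; split.
    - by rewrite -!scalemxAl TT'T.
    - rewrite bfZl bfZr proj // mulrA -expr2 exprVn sqr_sqrtr ?ltW //.
      by rewrite mulVf // gt_eqF.
    - rewrite bfZl bfZr proj // => [|v /kerT[]//].
      by rewrite mulrA mulr_ge0 // -expr2 sqr_ge0.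
  have kerF w : w *m T = 0 -> qf T w = 0 /\ qf F w = 0.
    by move=> wT; rewrite !(bf_eq0 _) //; case: (kerT _ wT).
  (* If [C] is empty, [G >= 0] holds only on the kernel of [T], where both [T] and [F] vanish, and
     any [c] works. *)
  have [C0|C0] := pselect (C !=set0); last first.
    exists 1 => // w Gw; have [/kerF[-> ->]|wT] := eqVneq (w *m T) 0.
      by rewrite mulr0.
    by case: C0; eexists; apply: (normalize w wT Gw).2.
  have contF : {within C, continuous (fun w : 'rV[R]_p => qf F w)}.
    by apply: continuous_subspaceT; apply: qf_continuous.
  have [v + minF] := EVT_min_rV C0 (psd_compact Tpsd) contF.
  rewrite inE => -[vT Tv Gv].
  have vT0 : v *m T != 0.
    apply/eqP => vT0; move: Tv; rewrite bf_eq0 // => /esym/eqP.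
    by rewrite oner_eq0.
  exists (qf F v); first exact: FG.
  move=> w Gw; have [/kerF[-> ->]|wT] := eqVneq (w *m T) 0.
    by rewrite mulr0.
  have [Tw Cw] := normalize w wT Gw.
  have := minF _ (mem_set Cw); rewrite bfZl bfZr proj // => [|u /kerT[]//].
  by rewrite mulrA -expr2 exprVn sqr_sqrtr ?(ltW Tw) // ler_pdivlMl // mulrC.
have [||alpha alpha0 Falpha] := @S_lemma R p (F - c *: T) G _ Gsym slater _.
- by rewrite linearB linearZ /= Fsym Tsym.
- by move=> w Gw; rewrite bfDm bfNm bfZm subr_ge0 Fc.
exists alpha, c; split=> // w.
by have := Falpha w; rewrite bfDm bfNm bfZm lerBrDr.
Qed.

End StrictSLemma.

(** * From matrix-valued to scalar implications: the matrix S-lemma *)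

Section MatrixSLemma.
Variable R : realType.

Lemma posdef_unit p (S : 'M[R]_p) : posdefmx S -> S \in unitmx.
Proof.
move=> /posdefmxP[_ Spos]; rewrite -row_free_unit; apply: inj_row_free => v vS.
by apply/eqP; apply/idPn => /Spos; rewrite bf_eq0 // ltxx.
Qed.

Lemma posdef_bound p (S : 'M[R]_p) : posdefmx S ->
  exists2 k, 0 < k & forall u : 'rV_p, qf 1%:M u <= k * qf S u.
Proof.
move=> Spd; have [Ssym Spos] := (possemidefmxP S).1 (posdefmxW Spd).
have [k k0 bound] := psd_coord_bound (invmx S) (posdefmxW Spd).
(* The added 1 keeps the constant positive when [p%:R * k] is zero. *)
exists (p%:R * k + 1) => [|u]; first by rewrite ltr_wpDl ?mulr_ge0.
apply: (@le_trans _ _ (p%:R * k * qf S u)); last first.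
  by rewrite ler_wpM2r ?lerDl.
rewrite qf1 -mulrA -[p in p%:R]card_ord mulr_natl -sumr_const; apply: ler_sum => i _.
by apply: bound; rewrite mulmxK // posdef_unit.
Qed.

Lemma mulmx_col1 n q p (Z : 'M[R]_(q, n)) (x : 'M[R]_(p, n)) :
  x *m (col_mx 1%:M Z)^T = row_mx x (x *m Z^T).
Proof. by rewrite tr_col_mx mul_mx_row trmx1 mulmx1. Qed.

Lemma bf_mull p p' q (A : 'M[R]_(p, p')) (S : 'M_(p', q)) u v :
  bf (A *m S) u v = bf S (u *m A) v.
Proof. by rewrite /bf mulmxA. Qed.

Section SchurComplement.
Variables (n q : nat) (N11 : 'M[R]_n) (N12 Z : 'M[R]_(n, q)) (N22 : 'M[R]_q).
Let N := block_mx N11 N12 N12^T N22.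
Let S := N11 - Z *m N22 *m Z^T.
Let V := block_mx 1%:M Z 0 1%:M.
(* [N] is [V diag(S, N22) V^T]; [T] flips the sign of its negative part. *)
Let T := V *m block_mx S 0 0 (- N22) *m V^T.

Hypothesis N11sym : N11^T = N11.
Hypothesis N22psd : possemidefmx (- N22).
Hypothesis ZN22 : Z *m N22 = N12.
Hypothesis slater : exists Z0, posdefmx ((col_mx 1%:M Z0)^T *m N *m col_mx 1%:M Z0).

Let N22sym : N22^T = N22.
Proof. by case: N22psd => N22sym' _; apply: oppr_inj; rewrite -[RHS]N22sym' linearN. Qed.

Let Ssym : S^T = S.
Proof. by rewrite /S linearB /= !trmx_mul trmxK N11sym N22sym mulmxA. Qed.

Let Nsym : N^T = N.
Proof. by rewrite tr_block_mx trmxK N11sym N22sym. Qed.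

Let NE x y : qf N (row_mx x y) = qf S x - qf (- N22) (y + x *m Z).
Proof.
rewrite bf_block bfT bfDm !bfNm bf_mul -ZN22 bf_mull !bfDl !bfDr.
by rewrite (bf_sym y (x *m Z)) //; ring.
Qed.

Let TE x y : qf T (row_mx x y) = qf S x + qf (- N22) (y + x *m Z).
Proof.
rewrite bf_mul mul_row_block mulmx0 !mulmx1 addr0 bf_block !bf0m !addr0.
by rewrite [x *m Z + y]addrC.
Qed.

(** On the vectors [(x, x Z0^T)] the form of [N] is positive, and the form of [S] at [x] exceeds it
    by a nonnegative square term. *)
Let Spd : posdefmx S.
Proof.
have [Z0 /posdefmxP[_ NZ0]] := slater.
apply/posdefmxP; split=> // x /NZ0.
rewrite -[X in _ *m X]trmxK bf_mul mulmx_col1 NE subr_gt0; apply: le_lt_trans.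
by case/possemidefmxP: N22psd.
Qed.

Let Tpsd : possemidefmx T.
Proof.
have [_ Spos] := (possemidefmxP S).1 (posdefmxW Spd).
have [_ N22pos] := (possemidefmxP _).1 N22psd.
apply/possemidefmxP; split=> [|w]; last first.
  by rewrite -[w]hsubmxK TE addr_ge0.
by rewrite !trmx_mul trmxK tr_block_mx Ssym !trmx0 linearN /= N22sym mulmxA.
Qed.

(** After the shift by [Z], the rank one map [v |-> (bf S v x / a) yt] sends [x] to [yt].
    Cauchy-Schwarz for [S] and [qf (- N22) yt <= a] keep the form of [N] nonnegative on its whole
    graph. *)
Let interpolate x y : x != 0 -> 0 <= qf N (row_mx x y) ->
  exists2 Y, x *m Y = y & forall v, 0 <= qf N (row_mx v (v *m Y)).
Proof.
have [_ Spos] := (posdefmxP S).1 Spd.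
move=> /Spos; set a := qf S x => a0.
rewrite NE; set yt := y + x *m Z; rewrite -/a subr_ge0 => yta.
have vY v : v *m (a^-1 *: (S *m x^T *m yt) - Z) = (a^-1 * bf S v x) *: yt - v *m Z.
  rewrite mulmxBr -scalemxAr !mulmxA [v *m S *m x^T]mx11_scalar mul_scalar_mx.
  by rewrite scalerA.
exists (a^-1 *: (S *m x^T *m yt) - Z) => [|v].
  by rewrite vY mulVf ?gt_eqF // scale1r addrK.
rewrite NE vY subrK bfZl bfZr.
have := cauchy_schwarz_psd v x (posdefmxW Spd); rewrite -/a => vx.
rewrite subr_ge0 mulrA -expr2 exprMn exprVn.
apply: (@le_trans _ _ ((a ^+ 2)^-1 * bf S v x ^+ 2 * a)).
  by rewrite ler_wpM2l // mulr_ge0 ?sqr_ge0 // invr_ge0 sqr_ge0.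
have -> : (a ^+ 2)^-1 * bf S v x ^+ 2 * a = bf S v x ^+ 2 / a.
  by field; rewrite gt_eqF.
by rewrite ler_pdivrMr.
Qed.

(** Interpolation turns the hypothesis on all [Y] into an implication between the forms of [N] and
    of [M], to which the strict S-lemma applies modulo the kernel of [T]. The margin in [T]
    dominates one in [S], hence one in the identity. *)
Lemma matrix_S_lemma (P : 'M[R]_n) (F : 'M[R]_(q, n)) : posdefmx P ->
  (forall Y, (forall x, 0 <= qf N (row_mx x (x *m Y))) ->
     forall x, x != 0 -> qf P (x *m Y *m F) < qf P x) ->
  exists alpha beta, [/\ 0 <= alpha, 0 < beta &
    forall x y, alpha * qf N (row_mx x y) + beta * qf 1%:M x <=
      qf P x - qf P (y *m F)].
Proof.
move=> Ppd stab; have [Psym Ppos] := (posdefmxP P).1 Ppd.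
have [_ Spos] := (posdefmxP S).1 Spd.
have [_ N22pos] := (possemidefmxP _).1 N22psd.
have stab1 x y : x != 0 -> 0 <= qf N (row_mx x y) -> qf P (y *m F) < qf P x.
  move=> x0 Nxy; have [Y <- NY] := interpolate x0 Nxy; exact: stab.
pose M := block_mx P 0 0 (- (F *m P *m F^T)).
have Msym : M^T = M.
  by rewrite tr_block_mx !trmx0 Psym linearN /= !trmx_mul trmxK Psym mulmxA.
have ME x y : qf M (row_mx x y) = qf P x - qf P (y *m F).
  by rewrite bf_block !bf0m !addr0 bfNm bf_mul.
(* Along the kernel of [N22], the condition [qf N >= 0] does not bound [y], so [F] must vanish there
   for the decrease to hold. *)
have yF0 (y : 'rV[R]_q) : y *m N22 = 0 -> y *m F = 0.
  move=> yN22; apply/eqP; apply/idPn => d0; set d := y *m F in d0.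
  (* the ray [t |-> (d, t y - d Z)] stays in [qf N >= 0] *)
  set b := - (d *m Z *m F).
  have ray t : qf P (b + t *: d) < qf P d.
    have -> : b + t *: d = (- (d *m Z) + t *: y) *m F.
      by rewrite mulmxDl mulNmx -scalemxAl.
    apply: stab1 => //; rewrite NE addrAC addNr add0r bfNm bfZl.
    rewrite (bf_eq0 yN22) mulr0 oppr0 subr0; exact/ltW/Spos.
  have := ray 0; have := Ppos _ d0; set c := qf P d => c0 _.
  (* Chosen so that the pairing of [b + t d] with [d] is [(c + 1) c]; Cauchy-Schwarz then gives
     [qf P (b + t d) >= (c + 1)^2 c > c], against [ray]. *)
  pose t := (c + 1 - bf P b d / c).
  have := cauchy_schwarz_psd (b + t *: d) d (posdefmxW Ppd).
  have -> : bf P (b + t *: d) d = (c + 1) * c.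
    by rewrite bfDl bfZl -/c /t; field; rewrite gt_eqF.
  have := ray t; rewrite -/c; move: (qf P (b + _)) => r rc; nra.
have kerT (w : 'rV[R]_(n + q)) : w *m T = 0 -> w *m M = 0 /\ w *m N = 0.
  move=> wT; have := bf_eq0 wT w; rewrite -[w]hsubmxK TE.
  move: (lsubmx w) (rsubmx w) => x y Txy.
  have x0 : x = 0.
    apply/eqP; apply/idPn => /Spos; have := N22pos (y + x *m Z); lra.
  move: Txy; rewrite x0 bf0l mul0mx add0r addr0 => /(psd_ker N22psd) yN22.
  have {}yN22 : y *m N22 = 0 by apply: oppr_inj; rewrite -mulmxN oppr0.
  rewrite !mul_row_block !mul0mx !add0r mulmx0 mulmxN !mulmxA yF0 // yN22.
  rewrite !mul0mx oppr0 -ZN22 trmx_mul N22sym mulmxA yN22 mul0mx.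
  by rewrite row_mx0.
have posM (w : 'rV[R]_(n + q)) : w *m T != 0 -> 0 <= qf N w -> 0 < qf M w.
  rewrite -[w]hsubmxK; move: (lsubmx w) (rsubmx w) => x y Txy Nxy.
  rewrite ME subr_gt0; apply: stab1 => //; apply: contraNneq Txy => x0.
  apply/eqP/(psd_ker Tpsd); move: Nxy (N22pos (y + x *m Z)).
  by rewrite NE TE x0 bf0l; lra.
(* With [n = 0] the form of [N] is nowhere positive and the S-lemma has no Slater point; every term
   but the one in [alpha] vanishes, so [alpha = 0] works. *)
have [[x0 xn0]|noX] := pselect (exists x : 'rV[R]_n, x != 0); last first.
  have all0 (x : 'rV[R]_n) : x = 0.
    by apply/eqP; apply/idPn => x0; apply: noX; exists x.
  exists 0, 1; split=> // x y; rewrite [x]all0 [y *m F]all0 !bf0l; lra.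
have slaterN : exists w, 0 < qf N w.
  by exists (row_mx x0 (- (x0 *m Z))); rewrite NE addNr bf0l subr0; exact: Spos.
have [alpha [c [alpha0 c0 FN]]] :=
  strict_S_lemma Tpsd Msym Nsym kerT slaterN posM.
have [k k0 kS] := posdef_bound Spd.
exists alpha, (c / k); split=> [//||x y]; first exact: divr_gt0.
rewrite -ME; apply: le_trans (FN _); rewrite lerD2l TE -mulrA.
rewrite ler_wpM2l ?(ltW c0) // ler_pdivrMl // (le_trans (kS x)) //.
by rewrite ler_wpM2l ?(ltW k0) // lerDl.
Qed.

End SchurComplement.
End MatrixSLemma.

(** * Application to the data, the matrix inequality and stability *)

Section Stabilization.
Variable R : realType.

(** If [D S D^T] kills a column [c], then [D^T c] is isotropic for the definite [S], hence zero.
    This provides the range condition for the pseudo-inverse in [LambdaX_block]. *)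
Lemma negdef_trmx_sub p q (S : 'M[R]_p) (D : 'M[R]_(q, p)) :
  negdefmx S -> (D^T <= D *m S *m D^T)%MS.
Proof.
move=> /negdefmxP[Ssym Sneg]; rewrite submxE; apply/eqP.
set c := cokermx _; apply: trmx_inj; rewrite trmx0 trmx_mul trmxK.
apply/row_matrixP => i; rewrite row0 row_mul; set v := row i _.
apply/eqP; apply/idPn => /Sneg; rewrite -bf_mul /bf -[_ *m v^T]mulmxA.
have -> : v^T = col i c by rewrite /v tr_row trmxK.
by rewrite colE [_ *m (c *m _)]mulmxA mulmx_coker mul0mx mulmx0 mxE ltxx.
Qed.

Section Data.
Variables (n m M N : nat) (U : 'M[R]_(m, N)) (X : 'M[R]_(n, N.+1)).
Variables (Rm : 'M[R]_(M, N)) (Q : 'M[R]_(n + M)).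

(** For [Y = [A B]], the matrix before [Rm^T] is the noise that the data equation assigns to the
    system. *)
Lemma qf_LambdaX (x : 'rV[R]_n) (Y : 'M[R]_(n, n + m)) :
  qf (LambdaX U X Rm Q) (row_mx x (x *m Y)) =
  qf Q (row_mx x (x *m (Xplus X - lsubmx Y *m Xminus X - rsubmx Y *m U) *m Rm^T)).
Proof.
rewrite bf_mul mul_row_block mulmx1 mulmx0 addr0.
suff -> : x *m (Xplus X *m Rm^T) +
    x *m Y *m col_mx (- (Xminus X *m Rm^T)) (- (U *m Rm^T)) =
    x *m (Xplus X - lsubmx Y *m Xminus X - rsubmx Y *m U) *m Rm^T by [].
rewrite -{1}[Y]hsubmxK -mulmxA mul_row_col -mulmxDr -mulmxA.
by rewrite !mulmxBl !mulmxN !mulmxA addrA.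
Qed.

Lemma qf_noise (E : 'M[R]_(n, N)) (x : 'rV[R]_n) :
  qf ((col_mx 1%:M (Rm *m E^T))^T *m Q *m col_mx 1%:M (Rm *m E^T)) x =
  qf Q (row_mx x (x *m E *m Rm^T)).
Proof.
by rewrite -[X in _ *m X]trmxK bf_mul mulmx_col1 trmx_mul trmxK mulmxA.
Qed.

(** The data equation determines [E] as the residual of [(A, B)], so the existential over noises
    disappears. *)
Lemma compatible_systemsP (A : 'M[R]_n) (B : 'M[R]_(n, m)) : Q^T = Q ->
  compatible_systems U X Rm Q (A, B) <->
  forall x, 0 <= qf (LambdaX U X Rm Q) (row_mx x (x *m row_mx A B)).
Proof.
move=> Qsym; split=> [[E [/possemidefmxP[_ noise] data]] x | LamAB].
  rewrite qf_LambdaX row_mxKl row_mxKr.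
  have -> : Xplus X - A *m Xminus X - B *m U = E.
    by rewrite data /= -[_ + _ + E]addrA [A *m _ + _]addrC addrK addrAC subrr add0r.
  by rewrite -qf_noise.
exists (Xplus X - A *m Xminus X - B *m U); split; last first.
  by rewrite /data_equation /= -[_ - _ - _]addrA -opprD [RHS]addrC subrK.
apply/possemidefmxP; split=> [|x].
  by rewrite !trmx_mul trmxK Qsym mulmxA.
by rewrite qf_noise; have := LamAB x; rewrite qf_LambdaX row_mxKl row_mxKr.
Qed.

(** Prepares [matrix_S_lemma]. The lower right block [D Q22 D^T] may be singular, but the upper
    right one is [C D^T], with rows in the row space of the former; the pseudo-inverse therefore
    solves [Z N22 = N12]. *)
Lemma LambdaX_block : Q^T = Q -> negdefmx (drsubmx Q) ->
  exists N11 N12 Z N22, [/\ LambdaX U X Rm Q = block_mx N11 N12 N12^T N22,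
    N11^T = N11, possemidefmx (- N22) & Z *m N22 = N12].
Proof.
move=> Qsym Q22neg; have [Q22sym Q22lt0] := (negdefmxP _).1 Q22neg.
have LamT : (LambdaX U X Rm Q)^T = LambdaX U X Rm Q.
  by rewrite !trmx_mul trmxK Qsym mulmxA.
set Lam := LambdaX U X Rm Q in LamT *.
have [D [C [Ldr Lur]]] : exists D C,
    drsubmx Lam = D *m drsubmx Q *m D^T /\ ursubmx Lam = C *m D^T.
  set D := col_mx (- (Xminus X *m Rm^T)) (- (U *m Rm^T)).
  exists D, (ursubmx Q + Xplus X *m Rm^T *m drsubmx Q).
  rewrite /Lam /LambdaX /LambdaX_factor -/D -[Q in _ *m Q *m _]submxK.
  rewrite tr_block_mx trmx0 !mulmx_block block_mxKdr block_mxKur.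
  by rewrite !(mul0mx, mulmx0, mul1mx, add0r).
exists (ulsubmx Lam), (ursubmx Lam), (ursubmx Lam *m pinvmx (drsubmx Lam)).
exists (drsubmx Lam); split.
- by rewrite trmx_ursub LamT submxK.
- by rewrite trmx_ulsub LamT.
- apply/possemidefmxP; split=> [|u]; first by rewrite linearN /= trmx_drsub LamT.
  rewrite bfNm Ldr bf_mul oppr_ge0.
  by have [->|/Q22lt0/ltW//] := eqVneq (u *m D) 0; rewrite bf0l.
- apply: mulmxKpV; rewrite Lur Ldr.
  exact: submx_trans (submxMl _ _) (negdef_trmx_sub D Q22neg).
Qed.

(* Completing the square in [z]: Schur complement with respect to [P]. *)
Lemma qf_stabilization_lmi (K : 'M[R]_(m, n)) (P : 'M[R]_n) alpha beta
    (x y z : 'rV[R]_n) (y' : 'rV[R]_m) : P^T = P ->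
  qf (lmi_blocks (K *m P) P beta - alpha *: block_mx (LambdaX U X Rm Q) 0 0 0)
     (row_mx (row_mx x (row_mx y y')) z) =
  qf P x - qf P (y + y' *m K) - alpha * qf (LambdaX U X Rm Q) (row_mx x (row_mx y y'))
    - beta * qf 1%:M x + qf P (z + y' *m K).
Proof.
move=> Psym; rewrite bfDm bfNm bfZm /lmi_blocks !bf_block !bf_col !bf_row !bf0m.
rewrite !bfNm !bfT bfDm bfNm -(scalemx1 _ beta) bfZm !bf_mull !bfDl !bfDr.
rewrite (bf_sym y (y' *m K)) // (bf_sym z (y' *m K)) //; ring.
Qed.

Lemma stabilization_lmiP (K : 'M[R]_(m, n)) (P : 'M[R]_n) alpha beta :
  Q^T = Q -> posdefmx P ->
  stabilization_lmi U X Rm Q (K *m P) P alpha beta <->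
  forall x y, alpha * qf (LambdaX U X Rm Q) (row_mx x y) + beta * qf 1%:M x <=
    qf P x - qf P (y *m col_mx 1%:M K).
Proof.
move=> Qsym /posdefmxW/possemidefmxP[Psym Ppos].
have yK (y : 'rV[R]_(n + m)) :
    y *m col_mx 1%:M K = lsubmx y + rsubmx y *m K.
  by rewrite -{1}[y]hsubmxK mul_row_col mulmx1.
split=> [/possemidefmxP[_ lmi] x y|lmi].
  (* The last component is the [z] that annihilates the completed square. *)
  have := lmi (row_mx (row_mx x (row_mx (lsubmx y) (rsubmx y))) (- (rsubmx y *m K))).
  by rewrite qf_stabilization_lmi // addNr bf0l hsubmxK yK; lra.
apply/possemidefmxP; split=> [|w].
  rewrite /lmi_blocks linearB linearZ /= !tr_block_mx !tr_col_mx !tr_row_mx.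
  rewrite !linearB /= !linearN /= tr_scalar_mx !trmx0 Psym trmxK.
  by rewrite !trmx_mul !trmxK Qsym !mulmxA.
rewrite -[w]hsubmxK -[lsubmx w]hsubmxK -[rsubmx (lsubmx w)]hsubmxK.
move: (rsubmx w) (lsubmx (lsubmx w)) => z x.
move: (lsubmx (rsubmx _)) (rsubmx (rsubmx _)) => y y'.
rewrite qf_stabilization_lmi //; have := Ppos (z + y' *m K).
have := lmi x (row_mx y y'); rewrite yK row_mxKl row_mxKr; lra.
Qed.

(** On the graph [y = x [A B]] of a compatible system the multiplier term is nonnegative, and [beta]
    makes the decrease strict. *)
Lemma lmi_stabilizes (K : 'M[R]_(m, n)) (P : 'M[R]_n) alpha beta A B :
  Q^T = Q -> posdefmx P -> 0 <= alpha -> 0 < beta ->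
  stabilization_lmi U X Rm Q (K *m P) P alpha beta ->
  compatible_systems U X Rm Q (A, B) ->
  negdefmx ((A + B *m K) *m P *m (A + B *m K)^T - P).
Proof.
move=> Qsym Ppd alpha0 beta0 /(stabilization_lmiP _ _ _ Qsym Ppd) lmi.
move=> /(compatible_systemsP _ _ Qsym) LamAB.
have [Psym _] := Ppd.
apply/negdefmxP; split=> [|x x0].
  by rewrite linearB /= !trmx_mul trmxK Psym mulmxA.
have : 0 < qf 1%:M x.
  rewrite lt_neqAle eq_sym; have /possemidefmxP[_ -> //] := psd1 R n.
  rewrite andbT; apply: contra x0 => /eqP/(psd_ker (psd1 R n)).
  by rewrite mulmx1 => ->.
move=> /(mulr_gt0 beta0); have := mulr_ge0 alpha0 (LamAB x).
have := lmi x (x *m row_mx A B).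
rewrite -mulmxA mul_row_col mulmx1 bfDm bfNm.
rewrite [qf (_ *m P *m _) x]bf_mul; lra.
Qed.

End Data.

Lemma lyapunov_stable n (S P : 'M[R]_n) : posdefmx P ->
  negdefmx (S *m P *m S^T - P) -> stablemx_dt S.
Proof.
move=> /posdefmxP[Psym Ppos] /negdefmxP[_ neg] z /eigenvalueP[v vS v0].
pose a := map_mx (@complex.Re R) v; pose b := map_mx (@complex.Im R) v.
case: z vS => x y vS.
have ReD (u w : R[i]) : complex.Re (u + w) = complex.Re u + complex.Re w.
  by case: u w => [? ?] [].
have ImD (u w : R[i]) : complex.Im (u + w) = complex.Im u + complex.Im w.
  by case: u w => [? ?] [].
have aS : a *m S = x *: a - y *: b.
  apply/rowP => j; move/rowP: vS => /(_ j); rewrite !mxE.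
  move=> /(congr1 (@complex.Re R)); rewrite (big_morph _ (id1 := 0) (op1 := +%R) ReD) //.
  case: (v 0 j) => c d /= <-; apply: eq_bigr => i _; rewrite !mxE.
  by case: (v 0 i) => c' d' /=; rewrite mulr0 subr0.
have bS : b *m S = x *: b + y *: a.
  apply/rowP => j; move/rowP: vS => /(_ j); rewrite !mxE.
  move=> /(congr1 (@complex.Im R)); rewrite (big_morph _ (id1 := 0) (op1 := +%R) ImD) //.
  case: (v 0 j) => c d /= <-; apply: eq_bigr => i _; rewrite !mxE.
  by case: (v 0 i) => c' d' /=; rewrite mulr0 add0r.
have ab0 : (a != 0) || (b != 0).
  rewrite -negb_and; apply: contra v0 => /andP[/eqP/rowP a0 /eqP/rowP b0].
  apply/eqP/rowP => j; move: (a0 j) (b0 j); rewrite !mxE.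
  by case: (v 0 j) => c d /= -> ->.
have decr (u : 'rV[R]_n) : u != 0 -> qf P (u *m S) < qf P u.
  by move=> /neg; rewrite bfDm bfNm bf_mul subr_lt0.
(* One of [a], [b] may be zero, so only the other is sure to decrease strictly. *)
have decr_le (u : 'rV[R]_n) : qf P (u *m S) <= qf P u.
  by have [->|/decr/ltW//] := eqVneq u 0; rewrite mul0mx.
have Pge0 (u : 'rV[R]_n) : 0 <= qf P u.
  by have [->|/Ppos/ltW//] := eqVneq u 0; rewrite bf0l.
have Pab : 0 < qf P a + qf P b.
  by case/orP: ab0 => /Ppos; [have := Pge0 b | have := Pge0 a]; lra.
have : qf P (a *m S) + qf P (b *m S) < qf P a + qf P b.
  case/orP: ab0 => /decr; [have := decr_le b | have := decr_le a]; lra.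
(* On [(a, b)], [S] acts as a rotation scaled by [|z|], so the cross terms in [bf P a b] cancel in
   the sum. *)
have -> : qf P (a *m S) + qf P (b *m S) = (x ^+ 2 + y ^+ 2) * (qf P a + qf P b).
  rewrite aS bS !bfDl !bfDr !bfNl !bfNr !bfZl !bfZr (bf_sym b a Psym); ring.
rewrite gtr_pMl // => xy1.
rewrite normc_def /= ltcR -sqrtr1 ltr_sqrt //.
Qed.

End Stabilization.

Unset Implicit Arguments.

Theorem proposition1 (R : realType) (n m M N : nat)
    (U : 'M[R]_(m, N)) (X : 'M[R]_(n, N.+1))
    (Rm : 'M[R]_(M, N)) (Q : 'M[R]_(n + M))
    (Qsym : Q^T = Q) (Q22neg : negdefmx (drsubmx Q))
    (slater : exists Z : 'M[R]_(n + m, n),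
       posdefmx ((col_mx 1%:M Z)^T *m LambdaX U X Rm Q *m col_mx 1%:M Z)) :
  (informative_quadratic_stabilization U X Rm Q <->
     exists (L : 'M[R]_(m, n)) (P : 'M[R]_n) (alpha beta : R),
       posdefmx P /\ 0 <= alpha /\ 0 < beta /\
       stabilization_lmi U X Rm Q L P alpha beta)
  /\
  (forall (L : 'M[R]_(m, n)) (P : 'M[R]_n),
     posdefmx P ->
     (exists alpha beta : R,
       0 <= alpha /\ 0 < beta /\ stabilization_lmi U X Rm Q L P alpha beta) ->
     forall (A : 'M[R]_n) (B : 'M[R]_(n, m)),
       compatible_systems U X Rm Q (A, B) ->
       stablemx_dt (A + B *m (L *m invmx P))).
Proof.
have gain (L : 'M[R]_(m, n)) (P : 'M[R]_n) : posdefmx P -> L = L *m invmx P *m P.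
  by move=> Ppd; rewrite mulmxKV // posdef_unit.
split; last first.
  move=> L P Ppd [alpha [beta [alpha0 [beta0]]]].
  rewrite {1}(gain L P Ppd) => lmi A B AB; apply: (lyapunov_stable Ppd).
  exact: (lmi_stabilizes Qsym Ppd alpha0 beta0 lmi AB).
split=> [[K [P [Ppd info]]]|[L [P [alpha [beta [Ppd [alpha0 [beta0 lmi]]]]]]]].
  have [N11 [N12 [Z [N22 [LamE N11sym N22psd ZN22]]]]] :=
    LambdaX_block U X Rm Qsym Q22neg.
  have := slater; rewrite LamE => slater'.
  have [|alpha [beta [alpha0 beta0 lmi]]] :=
      matrix_S_lemma N11sym N22psd ZN22 slater' (F := col_mx 1%:M K) Ppd.
    (* Nonnegativity on the graph of [Y = [A B]] is compatibility of [(A, B)], so informativity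
       supplies the decrease. *)
    rewrite -LamE => Y; rewrite -[Y]hsubmxK => /(compatible_systemsP _ _ _ _ _ Qsym).
    move=> /info /negdefmxP[_ neg] x /neg.
    by rewrite /= bfDm bfNm bf_mul subr_lt0 -mulmxA mul_row_col mulmx1.
  exists (K *m P), P, alpha, beta; do 3!split=> //.
  by apply/stabilization_lmiP => //; rewrite LamE.
exists (L *m invmx P), P; split=> // -[A B] AB /=.
rewrite {1}(gain L P Ppd) in lmi.
exact: (lmi_stabilizes Qsym Ppd alpha0 beta0 lmi AB).
Qed.
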